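(* Let $\mu_n^{(1)} \leq \cdots \leq \mu_n^{(n)}$ be the eigenvalues of the $n\times n$ LCM matrix $[S_n]=\big([i,j]\big)_{1\le i,j\le n}$ defined on $S_n=\{1,2,\ldots,n\}$, where $[i,j]$ denotes the least common multiple of $i$ and $j$. Then $$\frac{n+1}{2}-s(n-1)^{1/2} < \mu_n^{(1)} < \frac{n+1}{2}-\left(\frac{s^2+32(n-1)}{n-1}\right)^{1/2}$$ and $$\frac{n+1}{2}+\left(\frac{s^2+32(n-1)}{n-1}\right)^{1/2} < \mu_n^{(n)} < \frac{n+1}{2}+s(n-1)^{1/2},$$ where $$s=\left[\frac{1}{3n}\sum_{i=1}^n i^2\Big(N\big(N\mu\ast (N+1)(2N+1)\big)\ast\zeta\Big)(i)-\frac{7n^2+12n+5}{12}\right]^{1/2}.$$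
   Context: For arithmetical functions $f,g$ (functions on the positive integers), the Dirichlet product is $(f\ast g)(n)=\sum_{d\mid n} f(d)\,g(n/d)$, and the usual product is pointwise, $(fg)(n)=f(n)g(n)$. $N$ is the arithmetical function $N(n)=n$; $\mu$ (without indices) is the Möbius function; $\zeta$ is the arithmetical function $\zeta(n)=1$ for all $n$. The function $(N+1)(2N+1)$ is $t\mapsto (t+1)(2t+1)$, and $N\mu$ is the pointwise product $t\mapsto t\mu(t)$. The expression $N\big(N\mu\ast (N+1)(2N+1)\big)\ast\zeta$ means the Dirichlet product with $\zeta$ of the function $t\mapsto t\cdot\big(N\mu\ast (N+1)(2N+1)\big)(t)=t\sum_{d\mid t} d\mu(d)\,(t/d+1)(2t/d+1)$.
   Formalization: The formal theorem assumes n ≥ 4: the stated bounds are undefined for n = 1 (division by n−1), and the upper bound on the smallest eigenvalue fails for n = 2 (−0.56 versus −4.52) and n = 3 (−3.61 versus −4.98). *)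

(* Defs.v *)
From mathcomp Require Import all_boot all_order all_algebra.

Set Implicit Arguments.
Unset Strict Implicit.
Unset Printing Implicit Defensive.

Import Order.TTheory GRing.Theory Num.Theory.
Local Open Scope ring_scope.

(* Arithmetical functions are functions nat -> R; only their values at
   positive integers are meaningful, and their value at 0 is never used.
   Their pointwise product is MathComp's \* . *)

Definition dirichlet (R : nzRingType) (f g : nat -> R) (n : nat) : R :=
  \sum_(d <- divisors n) f d * g (n %/ d)%N.

Notation "f \ast g" := (dirichlet f g) (at level 40, left associativity).

Definition moebius (R : nzRingType) (n : nat) : R :=
  if all (fun p => logn p n == 1%N) (primes n)
  then (-1) ^+ size (primes n) else 0.

Definition arithN (R : nzRingType) (n : nat) : R := n%:R.

Definition zeta (R : nzRingType) (n : nat) : R := 1.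

(* Row and column indices of 'M_n start at 0, so i : 'I_n stands for the
   element i.+1 of {1, ..., n}. *)
Definition lcm_mx (R : nzRingType) (n : nat) : 'M[R]_n :=
  \matrix_(i < n, j < n) (lcmn i.+1 j.+1)%:R.

(* mu lists all the eigenvalues of A, with algebraic multiplicity, in
   nondecreasing order. *)
Definition ordered_eigenvalues (R : rcfType) (n : nat) (A : 'M[R]_n)
    (mu : n.-tuple R) : Prop :=
  sorted <=%R mu /\ char_poly A = \prod_(x <- mu) ('X - x%:P).

(* Main.v *)
Require Import Defs.
From mathcomp Require Import all_boot all_order all_algebra.
From mathcomp Require Import ring lra zify complex.
Import Order.TTheory GRing.Theory Num.Theory.
Local Open Scope ring_scope.

(* Put m = (n + 1) / 2 and let the y_k be the eigenvalues minus m.  Since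
   [i,j] = i * (j / gcd(i,j)), Moebius inversion turns the sum in s into the
   trace of the squared matrix, so sum_k y_k = 0 and sum_k y_k^2 = n s^2.
   The Rayleigh quotients at e_(n-1) - e_n and e_(n-1) + e_n show that both
   extreme deviations have absolute value at least n^2 - 3n/2 + 1, whereas
   [i,j] <= ij bounds s^2 by a sextic polynomial over n; this gives the inner
   bounds for n >= 4.  Cauchy-Schwarz gives the outer bounds, and equality in
   one of them would force the opposite extreme deviation y to satisfy
   (n - 1) y^2 <= s^2, which the inner bound excludes. *)

(** * Spectral decomposition of real symmetric matrices *)

Lemma char_poly_conj (F : fieldType) (n : nat) (P D : 'M[F]_n) :
  P \in unitmx -> char_poly (invmx P *m D *m P) = char_poly D.
Proof.
move=> uP; pose Q := map_mx polyC P; pose Q' := map_mx polyC (invmx P).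
have QQ : Q' *m Q = 1%:M by rewrite -map_mxM mulVmx // map_mx1.
rewrite /char_poly.
have -> : char_poly_mx (invmx P *m D *m P) = Q' *m char_poly_mx D *m Q.
  rewrite /char_poly_mx mulmxBr mulmxBl -!map_mxM; congr (_ - _).
  by rewrite scalar_mxC -mulmxA QQ mulmx1.
by rewrite !det_mulmx mulrAC -det_mulmx QQ det1 mul1r.
Qed.

(** The spectral theorem is applied over [R[i]], where the image of [A] is Hermitian. Its
    eigenvalues are real, so every identity descends to [R] by injectivity of the embedding. The
    weights [w] express quadratic forms without real eigenvectors. *)
Lemma symmetric_spectrum (R : rcfType) (n : nat) (A : 'M[R]_n) :
  A^T = A ->
  exists d : 'I_n -> R,
  [/\ char_poly A = \prod_i ('X - (d i)%:P),
      \tr A = \sum_i d i,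
      \tr (A *m A) = \sum_i d i ^+ 2 &
      forall v : 'rV[R]_n, exists2 w : 'I_n -> R, (forall i, 0 <= w i) &
        (v *m v^T) 0 0 = \sum_i w i /\ (v *m A *m v^T) 0 0 = \sum_i w i * d i].
Proof.
move=> symA; pose toC : {rmorphism R -> R[i]} := real_complex R.
have toC_real x : toC x \is Num.real by apply/complex_realP; exists x.
have trE (B : 'M[R]_n) : \tr (map_mx toC B) = toC (\tr B) by exact: trace_map_mx.
have toCI : injective toC := @complexI R.
pose AC := map_mx toC A; pose P := spectralmx AC; pose sp := spectral_diag AC.
have herm : AC \is hermsymmx.
  apply: realsym_hermsym; last by apply/mxOverP => i j; rewrite mxE.
  by apply/is_hermitianmxP; rewrite /= expr0 scale1r map_mx_id // map_trmx symA.
have AE : AC = invmx P *m diag_mx sp *m P.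
  by apply/orthomx_spectralP/hermitian_normalmx.
have uP : P \in unitmx by exact: spectral_unit.
have spE i : sp 0 i = toC (complex.Re (sp 0 i)).
  by rewrite [toC _]RRe_real //; apply/mxOverP/hermitian_spectral_diag_real.
exists (fun i => complex.Re (sp 0 i)); split.
- apply: (map_poly_inj toC); rewrite map_char_poly -/AC AE char_poly_conj //.
  rewrite char_poly_trig ?diag_mx_is_trig // map_prod_XsubC.
  by apply: eq_bigr => i _; rewrite mxE eqxx mulr1n -spE.
- apply: toCI; rewrite [RHS]rmorph_sum -trE -/AC AE mxtrace_mulC mulmxA mulmxV //.
  by rewrite mul1mx mxtrace_diag; apply: eq_bigr => i _; rewrite -spE.
- apply: toCI; rewrite [RHS]rmorph_sum -trE map_mxM -/AC AE.
  rewrite !mulmxA mulmxK // mxtrace_mulC !mulmxA mulmxV // mul1mx mulmx_diag mxtrace_diag.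
  by apply: eq_bigr => i _; rewrite mxE rmorphXn expr2 -spE.
(* [y] holds the coordinates of [v] in a unitary eigenbasis, and the weights are their squared
   moduli. *)
move=> v; pose y := P *m (map_mx toC v)^T; pose w i := `|y i 0| ^+ 2.
have wE i : w i = toC (complex.Re (w i)).
  by rewrite [toC _]RRe_real // realX // normr_real.
exists (fun i => complex.Re (w i)).
  by move=> i; rewrite -ler0c -[_%:C%C]/(toC _) -wE exprn_ge0.
have yE : map_mx toC v *m invmx P = map_mx Num.conj y^T.
  rewrite invmx_unitary ?spectral_unitarymx // trmx_mul trmxK map_mxM.
  by congr (_ *m _); apply/matrixP => i j; rewrite !mxE [RHS]conj_Creal.
split; apply: toCI; rewrite [RHS]rmorph_sum.
  transitivity ((map_mx toC v *m invmx P *m y) 0 0).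
    by rewrite -mulmxA mulKmx // map_trmx -map_mxM [RHS]mxE.
  by rewrite yE mxE; apply: eq_bigr => i _; rewrite -wE /w normCKC 2!mxE.
transitivity ((map_mx toC v *m invmx P *m diag_mx sp *m y) 0 0).
  have -> : map_mx toC v *m invmx P *m diag_mx sp *m y
      = map_mx toC v *m AC *m (map_mx toC v)^T.
    by rewrite AE !mulmxA.
  by rewrite map_trmx -!map_mxM [RHS]mxE.
rewrite yE mxE; apply: eq_bigr => i _.
by rewrite mul_mx_diag rmorphM -wE -spE /w normCKC 3!mxE mulrAC.
Qed.

(** * Moebius function and divisor sums *)

Lemma moebius_sq_dvd (R : nzRingType) (p n : nat) :
  (0 < n)%N -> prime p -> (p ^ 2 %| n)%N -> moebius R n = 0.
Proof.
move=> n_gt0 pr_p; rewrite pfactor_dvdn // => le2.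
have p_n : p \in primes n.
  by rewrite -logn_gt0 (leq_trans _ le2).
rewrite /moebius; case: ifP => // /allP/(_ p p_n)/eqP logn1.
by rewrite logn1 in le2.
Qed.

Lemma moebius_prime_mul (R : nzRingType) (p n : nat) :
  (0 < n)%N -> prime p -> ~~ (p %| n)%N -> moebius R (p * n) = - moebius R n.
Proof.
move=> n_gt0 pr_p pNn; have p_gt0 := prime_gt0 pr_p.
have pNin : p \notin primes n by rewrite mem_primes (negPf pNn) !andbF.
have primes_pn : perm_eq (primes (p * n)) (p :: primes n).
  apply: uniq_perm; rewrite /= ?pNin ?primes_uniq // => q.
  by rewrite primesM // primes_prime // inE in_cons.
rewrite /moebius (perm_all _ primes_pn) (perm_size primes_pn) /=.
rewrite lognM // lognE pr_p p_gt0 dvdnn divnn p_gt0 logn1 -/(logn _ _).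
rewrite [logn p n]lognE (negPf pNn) !andbF addn0 eqxx /=.
have -> : all (fun q => logn q (p * n) == 1%N) (primes n)
        = all (fun q => logn q n == 1%N) (primes n).
  apply: eq_in_all => q q_n; rewrite lognM // [logn q p]logn_prime //.
  by case: (eqVneq q p) q_n pNin => [-> p_n /negP[]|].
by case: ifP => _; rewrite ?oppr0 // exprS mulN1r.
Qed.

Lemma sum_moebius_divisors (R : nzRingType) (n : nat) :
  (0 < n)%N -> \sum_(d <- divisors n) moebius R d = (n == 1)%:R.
Proof.
move=> n_gt0; case: eqVneq => [->|n_neq1]; first by rewrite big_seq1.
have n_gt1 : (1 < n)%N by case: n n_gt0 n_neq1 => [|[]].
pose p := pdiv n; have pr_p : prime p by exact: pdiv_prime.
have p_n : (p %| n)%N by exact: pdiv_dvd.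
have p_gt0 := prime_gt0 pr_p.
(* The divisors are split by whether [p] divides [d], then whether [p ^ 2] does; the terms with
   [p ^ 2] dividing [d] vanish. *)
rewrite (bigID (fun d => p %| d)%N) /= (bigID (fun d => p %| d %/ p)%N) /=.
rewrite big_seq_cond big1 => [|d /and3P[d_n p_d pp_d]]; last first.
  apply: (moebius_sq_dvd _ p) => //; last by rewrite expnS expn1 -dvdn_divRL.
  by rewrite (dvdn_gt0 n_gt0) // dvdn_divisors.
(* The divisors d and p * d with p not dividing d cancel pairwise. *)
pose s := [seq d <- divisors n | ~~ (p %| d)%N].
have perm_s : perm_eq [seq d <- divisors n | (p %| d)%N && ~~ (p %| d %/ p)%N]
                      [seq (p * d)%N | d <- s].
  apply: uniq_perm; first by rewrite filter_uniq ?divisors_uniq.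
    rewrite map_inj_uniq ?filter_uniq ?divisors_uniq // => x y /eqP.
    by rewrite eqn_pmul2l // => /eqP.
  move=> d; rewrite mem_filter; apply/idP/mapP => [/andP[/andP[p_d pNd] d_n]|[e]].
    exists (d %/ p)%N; last by rewrite mulnC divnK.
    rewrite mem_filter pNd -dvdn_divisors //.
    by rewrite (dvdn_trans (dvdn_div p_d)) ?dvdn_divisors.
  rewrite mem_filter => /andP[pNe e_n] ->; rewrite dvdn_mulr // mulKn // pNe /=.
  by rewrite -dvdn_divisors // Gauss_dvd ?prime_coprime // p_n dvdn_divisors.
rewrite -big_filter (perm_big _ perm_s) big_map big_filter add0r.
rewrite -big_split big_seq_cond big1 //= => d /andP[d_n pNd].
rewrite moebius_prime_mul ?addNr // (dvdn_gt0 n_gt0) // dvdn_divisors //.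
Qed.

Lemma sum_multiples (V : nmodType) (e q : nat) (f : nat -> V) : (0 < e)%N ->
  \sum_(1 <= k < (e * q).+1 | (e %| k)%N) f k = \sum_(1 <= l < q.+1) f (e * l)%N.
Proof.
move=> e_gt0.
have perm_e : perm_eq [seq k <- index_iota 1 (e * q).+1 | (e %| k)%N]
                      [seq (e * l)%N | l <- index_iota 1 q.+1].
  apply: uniq_perm; first by rewrite filter_uniq ?iota_uniq.
    rewrite map_inj_uniq ?iota_uniq // => x y /eqP.
    by rewrite eqn_pmul2l // => /eqP.
  move=> k; rewrite mem_filter mem_index_iota.
  apply/andP/mapP => [[/dvdnP[l ->]]|[l]].
    rewrite mulnC muln_gt0 e_gt0 ltnS leq_pmul2l // => l_q.
    by exists l; rewrite // mem_index_iota.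
  rewrite mem_index_iota => l_q ->.
  by rewrite dvdn_mulr // muln_gt0 e_gt0 ltnS leq_pmul2l.
by rewrite -big_filter (perm_big _ perm_e) big_map.
Qed.

(** * Sums of squares and of squared LCMs *)

Lemma sum_sq (R : comNzRingType) (q : nat) :
  6%:R * \sum_(1 <= l < q.+1) l%:R ^+ 2 = q%:R * ((q%:R + 1) * (2%:R * q%:R + 1)) :> R.
Proof.
elim: q => [|q IHq]; first by rewrite big_nil mulr0 mul0r.
by rewrite big_nat_recr // mulrDr IHq -natr1 /=; ring.
Qed.

(** The coprimality indicator is the sum of [moebius e] over the common divisors [e] of [n] and [k].
    Exchanging the sums and writing [k = e * l] leaves sums of squares up to [q = n / e], whose
    closed form produces [(q + 1) (2 q + 1)]; one factor [e] joins [q] to give [n]. *)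
Lemma sum_coprime_sq (R : comNzRingType) (n : nat) : (0 < n)%N ->
  6%:R * \sum_(1 <= k < n.+1 | coprime n k) k%:R ^+ 2
  = n%:R * ((arithN R \* moebius R)
              \ast (fun t => (arithN R t + 1) * (2%:R * arithN R t + 1))) n.
Proof.
move=> n_gt0.
transitivity (6%:R * \sum_(1 <= k < n.+1) \sum_(e <- divisors n | (e %| k)%N)
   k%:R ^+ 2 * moebius R e).
  congr (_ * _); rewrite big_mkcond; apply: eq_bigr => k _.
  have perm_g : perm_eq [seq e <- divisors n | (e %| k)%N] (divisors (gcdn n k)).
    apply: uniq_perm; rewrite ?filter_uniq ?divisors_uniq // => e.
    by rewrite mem_filter -!dvdn_divisors ?gcdn_gt0 ?n_gt0 // dvdn_gcd andbC.
  rewrite -big_distrr -big_filter (perm_big _ perm_g) /=.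
  rewrite sum_moebius_divisors ?gcdn_gt0 ?n_gt0 // /coprime.
  by case: eqP; rewrite ?mulr1 ?mulr0.
rewrite (exchange_big_dep predT) //= /dirichlet !big_distrr /=.
rewrite big_seq [RHS]big_seq; apply: eq_bigr => e.
rewrite -dvdn_divisors // => /dvdnP[q n_eq]; rewrite n_eq muln_gt0 in n_gt0 *.
have [q_gt0 e_gt0] := andP n_gt0.
rewrite -big_distrl mulnK // mulnC sum_multiples //=.
under eq_bigr do rewrite natrM exprMn.
rewrite -big_distrr /= /arithN natrM.
transitivity (e%:R ^+ 2 * moebius R e * (6%:R * \sum_(1 <= l < q.+1) l%:R ^+ 2)).
  by ring.
by rewrite sum_sq; ring.
Qed.

Lemma sum_lcm_sq_below (R : comNzRingType) (n : nat) : (0 < n)%N ->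
  \sum_(1 <= j < n.+1) (lcmn n j)%:R ^+ 2
  = n%:R ^+ 2 * \sum_(d <- divisors n) \sum_(1 <= k < d.+1 | coprime d k) k%:R ^+ 2 :> R.
Proof.
move=> n_gt0; pose g j := (n %/ gcdn n j)%N.
have gcd_gt0 j : (0 < gcdn n j)%N by rewrite gcdn_gt0 n_gt0.
(* Group the j by d = n / gcd(n, j); then j = (n / d) k with k coprime to d. *)
transitivity (\sum_(1 <= j < n.+1)
    \sum_(d <- divisors n | d == g j) (lcmn n j)%:R ^+ 2 : R).
  apply: eq_bigr => j _; rewrite big_mkcond.
  rewrite (bigD1_seq (g j)) ?divisors_uniq //=; last first.
    by rewrite -dvdn_divisors // dvdn_div // dvdn_gcdl.
  by rewrite eqxx big1 ?addr0 // => d /negPf ->.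
rewrite (exchange_big_dep predT) //= big_distrr /=.
rewrite big_seq [RHS]big_seq; apply: eq_bigr => d.
rewrite -dvdn_divisors // => /dvdnP[c n_eq].
have [c_gt0 d_gt0] : (0 < c)%N /\ (0 < d)%N by apply/andP; rewrite -muln_gt0 -n_eq.
transitivity (\sum_(1 <= j < (c * d).+1 | (c %| j)%N && (d == g j))
    (lcmn n j)%:R ^+ 2 : R).
  rewrite -n_eq; apply: eq_bigl => j; rewrite andb_idl // => /eqP dE.
  have := dvdn_gcdr n j; suff -> : gcdn n j = c by [].
  by apply/eqP; rewrite -(eqn_pmul2r d_gt0) -n_eq {1}dE /g mulnC divnK // dvdn_gcdl.
rewrite big_mkcondr sum_multiples // big_distrr [RHS]big_mkcond /=.
(* With [j = c * k], the condition [d = g j] says that [d] and [k] are coprime, and then [[n,j] = c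
   [d,k] = n k]. *)
apply: eq_bigr => k _; rewrite /g n_eq -muln_gcdr -muln_lcmr divnMl //.
have -> : (d == d %/ gcdn d k)%N = coprime d k.
  by rewrite eqn_div ?gcdn_gt0 ?d_gt0 ?dvdn_gcdl // -[X in (_ == X)%N]muln1 eqn_pmul2l.
case: ifP => // /eqP gcd1; have := muln_lcm_gcd d k; rewrite gcd1 muln1 => ->.
by rewrite !natrM; ring.
Qed.

(** Doubling the lower triangle counts the diagonal twice; the surplus is added on the left because
    [V] has no subtraction. *)
Lemma sum_symmetric_square (V : nmodType) (f : nat -> nat -> V) (n : nat) :
  (forall i j, f i j = f j i) ->
  (\sum_(i < n) \sum_(j < n) f i.+1 j.+1) + \sum_(1 <= i < n.+1) f i i
  = (\sum_(1 <= i < n.+1) \sum_(1 <= j < i.+1) f i j) *+ 2.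
Proof.
move=> symf; elim: n => [|n IHn]; first by rewrite big_ord0 !big_nil addr0 mul0rn.
rewrite big_ord_recr /= big_nat_recr // [in RHS]big_nat_recr //= mulrnDl -IHn.
under eq_bigr do rewrite big_ord_recr /=.
rewrite big_split /= big_ord_recr [X in _ = _ + X *+ 2]big_nat_recr //=.
rewrite !big_add1 !big_mkord mulr2n /=.
under [X in _ + X + _ + _]eq_bigr do rewrite symf.
by rewrite [LHS](AC (2*2*2) (1*5*((2*6)*(3*4)))).
Qed.

(** This links the sum in [s] to the squared entries of the matrix. The second term on the left is
    six times the sum of the squared diagonal entries. *)
Lemma sum_lcm_sq (R : comNzRingType) (n : nat) :
  6%:R * \sum_(i < n) \sum_(j < n) (lcmn i.+1 j.+1)%:R ^+ 2
    + n%:R * ((n%:R + 1) * (2%:R * n%:R + 1))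
  = 2%:R * \sum_(1 <= i < n.+1) i%:R ^+ 2 *
      ((arithN R \* ((arithN R \* moebius R)
          \ast (fun t => (arithN R t + 1) * (2%:R * arithN R t + 1)))) \ast zeta R) i.
Proof.
have symf i j : (lcmn i j)%:R ^+ 2 = (lcmn j i)%:R ^+ 2 :> R by rewrite lcmnC.
rewrite -sum_sq -mulrDr.
have -> : \sum_(1 <= l < n.+1) l%:R ^+ 2 = \sum_(1 <= l < n.+1) (lcmn l l)%:R ^+ 2 :> R.
  by apply: eq_bigr => i _; rewrite (lcmn_idPl (dvdnn i)).
rewrite (sum_symmetric_square _ (fun i j => (lcmn i j)%:R ^+ 2 : R)) //.
rewrite -[X in _ * X]mulr_natl mulrCA; congr (_ * _); rewrite big_distrr /=.
apply: eq_big_nat => i /andP[i_gt0 _] /=.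
rewrite sum_lcm_sq_below // mulrCA; congr (_ * _); rewrite big_distrr /=.
rewrite big_seq /dirichlet [RHS]big_seq; apply: eq_bigr => d.
rewrite -dvdn_divisors // => d_i; rewrite sum_coprime_sq ?(dvdn_gt0 i_gt0) //.
by rewrite /zeta mulr1.
Qed.

(** * Rayleigh quotients and ordered eigenvalues *)

Lemma quadratic_form_pair (R : comNzRingType) (n : nat) (A : 'M[R]_n)
    (p q : 'I_n) (c : R) :
  let v : 'rV_n := delta_mx 0 p + c *: delta_mx 0 q in
  (v *m A *m v^T) 0 0 = A p p + c * A q p + c * (A p q + c * A q q).
Proof.
rewrite /= linearD linearZ /= !trmx_delta mulmxDl -scalemxAl -!rowE mulmxDr -scalemxAr.
by rewrite -!colE !mxE.
Qed.

(** Two factorisations of the characteristic polynomial into monic linear factors agree up to order,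
    so [mu] permutes the values of [d]. The final inequalities are Rayleigh estimates at [e_p - e_q]
    and [e_p + e_q]. *)
Lemma symmetric_ordered_eigenvalues (R : rcfType) (n : nat) (A : 'M[R]_n) (mu : n.-tuple R) :
  A^T = A -> (0 < n)%N -> ordered_eigenvalues A mu ->
  exists d : 'I_n -> R,
  [/\ \tr A = \sum_i d i,
      \tr (A *m A) = \sum_i d i ^+ 2,
      exists i, d i = mu`_0,
      exists i, d i = mu`_n.-1 &
      forall p q, p != q ->
        2%:R * mu`_0 <= A p p + A q q - 2%:R * A p q /\
        A p p + A q q + 2%:R * A p q <= 2%:R * mu`_n.-1].
Proof.
move=> symA n_gt0 [sorted_mu char_mu].
have [d [charE trE tr2E formE]] := symmetric_spectrum _ _ _ symA.
have perm_d : perm_eq mu (codom d).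
  by apply: prod_XsubC_eq; rewrite -char_mu charE big_image.
have mem_d k : (k < n)%N -> exists i, d i = mu`_k.
  move=> k_n; have /codomP[i ->] : mu`_k \in codom d.
    by rewrite -(perm_mem perm_d) mem_nth ?size_tuple.
  by exists i.
have d_mu i : mu`_0 <= d i /\ d i <= mu`_n.-1.
  have : d i \in mu by rewrite (perm_mem perm_d) codom_f.
  move=> /(nthP 0)[k]; rewrite size_tuple => k_n <-.
  have le_mu := @sorted_leq_nth _ _ le_trans le_refl 0 mu sorted_mu.
  by split; apply: le_mu; rewrite ?inE ?size_tuple // -ltnS prednK.
have n1 : (n.-1 < n)%N by rewrite prednK.
exists d; split=> // [||p q pNq]; [exact: mem_d | exact: mem_d |].
have Aqp : A q p = A p q by rewrite -{1}symA mxE.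
have pair_form (c : R) : c ^+ 2 = 1 -> exists2 w : 'I_n -> R, (forall i, 0 <= w i) &
    2%:R = \sum_i w i /\ A p p + A q q + c * (2%:R * A p q) = \sum_i w i * d i.
  move=> c2; have [w w_ge0 [wE wdE]] := formE (delta_mx 0 p + c *: delta_mx 0 q).
  exists w => //; split.
    (* The form of the identity matrix gives the squared norm [1 + c ^+ 2 = 2], the total weight. *)
    have := quadratic_form_pair R n 1%:M p q c; rewrite /= mulmx1 wE => ->.
    rewrite !mxE !eqxx (negPf pNq) eq_sym (negPf pNq) /=.
    ring: c2.
  have := quadratic_form_pair R n A p q c; rewrite /= wdE Aqp => ->.
  ring: c2.
split.
  have [|w w_ge0 [-> E]] := pair_form (-1); first by rewrite sqrrN expr1n.
  rewrite -[X in _ - X]mul1r -mulNr E mulr_suml.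
  by apply: ler_sum => i _; apply: ler_wpM2l => //; case: (d_mu i).
have [|w w_ge0 [wE E]] := pair_form 1; first by rewrite expr1n.
rewrite -[X in _ + X]mul1r E wE mulr_suml.
by apply: ler_sum => i _; apply: ler_wpM2l => //; case: (d_mu i).
Qed.

(** * Strict Cauchy-Schwarz for centred families *)

Lemma centered_sq_lt (R : realFieldType) (n : nat) (y : 'I_n -> R) (S : R) (i j : 'I_n) :
  (1 < n)%N -> j != i -> \sum_k y k = 0 -> \sum_k y k ^+ 2 = n%:R * S ->
  S < (n%:R - 1) * y j ^+ 2 -> y i ^+ 2 < (n%:R - 1) * S.
Proof.
move=> n_gt1 jNi sum0 sumS lt_j; rewrite ltNge; apply/negP => le_i.
have x_gt1 : 1 < n%:R :> R by rewrite ltr1n.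
have x1_neq0 : n%:R - 1 != 0 :> R by lra.
have S_ge0 : 0 <= S.
  rewrite -(pmulr_rge0 _ (x := n%:R)) -?sumS; last by lra.
  by apply: sumr_ge0 => k _; exact: sqr_ge0.
(* [- c] is the mean of the [y k] with [k != i], so [sumC] computes their squared deviations from
   it. If the bound failed, that sum would be at most 0, forcing [y j = - c]; its nonnegativity then
   gives [(n - 1) (y j)^2 <= S], a contradiction. *)
pose c := y i / (n%:R - 1).
have cE : y i = (n%:R - 1) * c by rewrite /c mulrC divfK.
have sumC : \sum_(k | k != i) (y k + c) ^+ 2 = n%:R * (S - (n%:R - 1) * c ^+ 2).
  have full : \sum_k (y k + c) ^+ 2 = n%:R * S + n%:R * c ^+ 2.
    have sq k : (y k + c) ^+ 2 = y k ^+ 2 + y k * (2%:R * c) + c ^+ 2 by ring.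
    under eq_bigr do rewrite sq.
    rewrite !big_split /= sumS -mulr_suml sum0 mul0r addr0.
    by rewrite sumr_const card_ord -[X in _ + X = _]mulr_natl.
  move: full; rewrite (bigD1 i) //= cE => full.
  by apply: (addrI (((n%:R - 1) * c + c) ^+ 2)); rewrite full; ring.
have sq_le : (y j + c) ^+ 2 <= n%:R * (S - (n%:R - 1) * c ^+ 2).
  rewrite -sumC (bigD1 j) //= lerDl; apply: sumr_ge0 => k _; exact: sqr_ge0.
have S_le : S <= (n%:R - 1) * c ^+ 2.
  rewrite -(ler_pM2l (x := n%:R - 1)); last by lra.
  by move: le_i; rewrite cE exprMn; nra.
have yj : y j + c = 0.
  apply/eqP; rewrite -sqrf_eq0 eq_le sqr_ge0 andbT; nra.
have : y j ^+ 2 = c ^+ 2 by rewrite -(addrK c (y j)) yj sub0r sqrrN.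
have := sqr_ge0 (y j + c); nra.
Qed.

(** * Symmetry, traces and size of the LCM matrix *)

Lemma lcm_mx_sym (R : nzRingType) (n : nat) : (lcm_mx R n)^T = lcm_mx R n.
Proof. by apply/matrixP => i j; rewrite !mxE lcmnC. Qed.

Lemma mxtrace_lcm_mx (R : numFieldType) (n : nat) :
  \tr (lcm_mx R n) = n%:R * (n%:R + 1) / 2%:R.
Proof.
rewrite /mxtrace; under eq_bigr => i _ do rewrite mxE (lcmn_idPl (dvdnn _)).
elim: n => [|n IHn]; first by rewrite big_ord0 !mul0r.
by rewrite big_ord_recr /= IHn -natr1; field.
Qed.

Lemma mxtrace_lcm_mx_sq (R : comNzRingType) (n : nat) :
  \tr (lcm_mx R n *m lcm_mx R n) = \sum_(i < n) \sum_(j < n) (lcmn i.+1 j.+1)%:R ^+ 2.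
Proof.
apply: eq_bigr => i _; rewrite mxE; apply: eq_bigr => j _.
by rewrite !mxE lcmnC expr2.
Qed.

(** Since [[i,j] <= i j], the double sum is at most the square of the sum of [i ^ 2]; 36 is the
    square of the 6 in [sum_sq]. *)
Lemma sum_lcm_sq_le (R : realFieldType) (n : nat) :
  36%:R * \sum_(i < n) \sum_(j < n) (lcmn i.+1 j.+1)%:R ^+ 2
    <= (n%:R * ((n%:R + 1) * (2%:R * n%:R + 1))) ^+ 2 :> R.
Proof.
rewrite -sum_sq exprMn -natrX; apply: ler_wpM2l => //.
rewrite big_add1 big_mkord /= expr2 mulr_suml; apply: ler_sum => i _.
rewrite mulr_sumr; apply: ler_sum => j _.
rewrite -exprMn -natrM lerXn2r ?nnegrE // ler_nat dvdn_leq // dvdn_lcm.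
by rewrite dvdn_mulr // dvdn_mull.
Qed.

Theorem theorem3 (R : rcfType) (n : nat) (hn : (4 <= n)%N) (mu : n.-tuple R)
    (hmu : ordered_eigenvalues (lcm_mx R n) mu) :
  let N := arithN R in
  let N1_2N1 : nat -> R := fun t => (N t + 1) * (2%:R * N t + 1) in
  let s : R := Num.sqrt
    ((3%:R * n%:R)^-1 *
       (\sum_(1 <= i < n.+1)
          i%:R ^+ 2 * ((N \* ((N \* moebius R) \ast N1_2N1)) \ast zeta R) i)
     - (7%:R * n%:R ^+ 2 + 12%:R * n%:R + 5%:R) / 12%:R) in
  let mid : R := (n%:R + 1) / 2%:R in
  let inner : R :=
    Num.sqrt ((s ^+ 2 + 32%:R * (n%:R - 1)) / (n%:R - 1)) in
  let outer : R := s * Num.sqrt (n%:R - 1) in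
  (mid - outer < mu`_0 /\ mu`_0 < mid - inner) /\
  (mid + inner < mu`_n.-1 /\ mu`_n.-1 < mid + outer).
Proof.
move=> N N1_2N1 s mid inner outer.
have n_gt0 : (0 < n)%N by lia.
have [d [trE tr2E [imin min_d] [imax max_d] pair_le]] :=
  symmetric_ordered_eigenvalues _ _ _ _ (lcm_mx_sym R n) n_gt0 hmu.
set x : R := n%:R in s mid inner outer *.
have x_ge4 : 4%:R <= x by rewrite /x ler_nat.
set T : R := \sum_(i < n) \sum_(j < n) (lcmn i.+1 j.+1)%:R ^+ 2.
have Teq : \sum_i d i ^+ 2 = T by rewrite -tr2E mxtrace_lcm_mx_sq.
have sum_y : \sum_i (d i - mid) = 0.
  by rewrite sumrB -trE mxtrace_lcm_mx sumr_const card_ord -mulr_natl /mid -/x; field.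
pose S : R := T / x - mid ^+ 2.
have sum_y2 : \sum_i (d i - mid) ^+ 2 = x * S.
  have sq i : (d i - mid) ^+ 2 = d i ^+ 2 - (2%:R * mid) * (d i - mid) - mid ^+ 2 by ring.
  under eq_bigr do rewrite sq.
  rewrite !sumrB -mulr_sumr sum_y mulr0 subr0 Teq sumr_const card_ord -mulr_natl -/x /S.
  by field; lra.
have S_ge0 : 0 <= S.
  rewrite -(pmulr_rge0 _ (x := x)) -?sum_y2; last by lra.
  by apply: sumr_ge0 => i _; exact: sqr_ge0.
have sE : s = Num.sqrt S.
  congr Num.sqrt; rewrite /S /mid.
  have := sum_lcm_sq R n; rewrite -/T -/x -/N -/N1_2N1 => E.
  set F := \sum_(1 <= i < n.+1) _ in E *.
  (* Dividing by [3 x] gives [T / x + (x + 1) (2 x + 1) / 6], and subtracting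
     [(7 x^2 + 12 x + 5) / 12] turns the second summand into [- mid ^+ 2]. *)
  have -> : F = (6%:R * T + x * ((x + 1) * (2%:R * x + 1))) / 2%:R by rewrite E; field.
  by field; lra.
have s2E : s ^+ 2 = S by rewrite sE sqr_sqrtr.
have T_le : 36%:R * T <= (x * ((x + 1) * (2%:R * x + 1))) ^+ 2 by exact: sum_lcm_sq_le.
(* The Rayleigh quotient at [e_(n-1) - e_n] is [mid - alpha]; the one at [e_(n-1) + e_n] exceeds
   [mid] by [x^2 - x / 2 - 1], which is at least [alpha] because [x >= 2]. *)
pose alpha := x ^+ 2 - 3%:R / 2%:R * x + 1.
have alpha_gt : S + 32%:R * (x - 1) < (x - 1) * alpha ^+ 2.
  have S_le : 36%:R * S <= (x + 1) ^+ 2 * (x * (2%:R * x + 1) ^+ 2 - 9%:R).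
    rewrite -(ler_pM2l (x := x)); last by lra.
    have -> : x * (36%:R * S) = 36%:R * T - 9%:R * x * (x + 1) ^+ 2.
      by rewrite /S /mid; field; lra.
    apply: le_trans (lerB T_le (lexx _)) _; rewrite le_eqVlt.
    by apply/orP; left; apply/eqP; ring.
  have [t t_ge0 xE] : exists2 t, 0 <= t & x = t + 4%:R by exists (x - 4%:R); lra.
  (* Written in t = x - 4 the difference has only positive coefficients. *)
  have E : (x - 1) * alpha ^+ 2 - 32%:R * (x - 1)
      - (x + 1) ^+ 2 * (x * (2%:R * x + 1) ^+ 2 - 9%:R) / 36%:R
    = 8%:R / 9%:R * t ^+ 5 + 121%:R / 9%:R * t ^+ 4 + 718%:R / 9%:R * t ^+ 3
      + 4111%:R / 18%:R * t ^+ 2 + 1097%:R / 4%:R * t + 193%:R / 4%:R.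
    by rewrite /alpha xE; field.
  have := exprn_ge0 2 t_ge0; have := exprn_ge0 3 t_ge0.
  have := exprn_ge0 4 t_ge0; have := exprn_ge0 5 t_ge0.
  lra.
have alpha_gt0 : 0 < alpha by rewrite /alpha; nra.
have [p [q [pNq App Aqq Apq]]] : exists p q : 'I_n, [/\ p != q, lcm_mx R n p p = x - 1,
    lcm_mx R n q q = x & lcm_mx R n p q = x * (x - 1)].
  have h1 : (n.-2 < n)%N by lia.
  have h2 : (n.-1 < n)%N by lia.
  (* Indices start at 0, so these stand for [n - 1] and [n], which are coprime. *)
  exists (Ordinal h1), (Ordinal h2).
  have n1 : (n.-2.+1 = n.-1)%N by lia.
  have n2 : (n.-1.+1 = n)%N by lia.
  have xm1 : (n.-1)%:R = x - 1 by rewrite /x -[in RHS]n2 -natr1 addrK.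
  rewrite !mxE /= n1 n2 !(lcmn_idPl (dvdnn _)) xm1; split=> //.
    by rewrite -val_eqE /=; lia.
  have /eqP gcd1 : coprime n.-1 n by rewrite -[X in coprime _ X]n2 coprimenS.
  have := muln_lcm_gcd n.-1 n; rewrite gcd1.
  by rewrite muln1 => ->; rewrite natrM xm1 mulrC.
have [le_min le_max] := pair_le p q pNq; rewrite App Aqq Apq in le_min le_max.
have lo : alpha <= mid - mu`_0 by rewrite /mid /alpha; lra.
have hi : alpha <= mu`_n.-1 - mid by rewrite /mid /alpha; nra.
have inner_lt z : alpha <= z -> inner < z.
  move=> le_z; have z_gt0 : 0 < z by lra.
  rewrite -[z]ger0_norm ?ltW // -sqrtr_sqr ltr_sqrt ?exprn_gt0 //.
  rewrite ltr_pdivrMr; last by lra.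
  rewrite s2E [ltRHS]mulrC; apply: lt_le_trans alpha_gt _.
  by apply: ler_wpM2l; [lra | nra].
have S_lt z : alpha <= z -> S < (x - 1) * z ^+ 2.
  move=> le_z; apply: (lt_le_trans (y := (x - 1) * alpha ^+ 2)); first by lra.
  by apply: ler_wpM2l; [lra | nra].
have outer_gt z : 0 <= z -> z ^+ 2 < (x - 1) * S -> z < outer.
  move=> z_ge0 lt_z; rewrite /outer sE -sqrtrM // -[z]ger0_norm // -sqrtr_sqr.
  by rewrite ltr_sqrt ?[S * _]mulrC //; apply: le_lt_trans lt_z; exact: sqr_ge0.
(* The extremes lie on opposite sides of [mid], each at distance at least [alpha > 0]. *)
have max_ne_min : imax != imin.
  by apply/eqP => E; move: min_d max_d; rewrite E => ->; lra.
have n_gt1 : (1 < n)%N by lia.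
(* For each outer bound, the opposite extreme supplies the large deviation that excludes
   equality. *)
have lt_max : (d imax - mid) ^+ 2 < (x - 1) * S.
  apply: (centered_sq_lt _ _ _ _ imax imin n_gt1 _ sum_y sum_y2); first by rewrite eq_sym.
  by rewrite min_d -sqrrN opprB; apply: S_lt.
have lt_min : (mid - d imin) ^+ 2 < (x - 1) * S.
  rewrite -sqrrN opprB.
  apply: (centered_sq_lt _ _ _ _ imin imax n_gt1 max_ne_min sum_y sum_y2).
  by rewrite max_d; apply: S_lt.
rewrite min_d in lt_min; rewrite max_d in lt_max.
have := inner_lt _ lo; have := inner_lt _ hi.
have := outer_gt _ _ lt_min; have := outer_gt _ _ lt_max.
move=> /(_ ltac:(lra)) ? /(_ ltac:(lra)) ? ? ?.
by split; split; lra.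
Qed.
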